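(* Let $\mathscr{A}\in\mathbb{R}^{I_1\times\cdots\times I_M\times I_1\times\cdots\times I_M}$, $\mathscr{C}\in\mathbb{R}^{J_1\times\cdots\times J_N\times J_1\times\cdots\times J_N}$ and $\mathscr{D}\in\mathbb{R}^{I_1\times\cdots\times I_M\times J_1\times\cdots\times J_N}$, and suppose that the Sylvester tensor equation $\mathscr{A}*_M\mathscr{X}+\mathscr{X}*_N\mathscr{C}=\mathscr{D}$ is consistent, i.e. has a solution $\mathscr{X}\in\mathbb{R}^{I_1\times\cdots\times I_M\times J_1\times\cdots\times J_N}$. Then for any initial iteration tensor $\mathscr{X}^{(1)}\in\mathbb{R}^{I_1\times\cdots\times I_M\times J_1\times\cdots\times J_N}$, Algorithm G (defined in the context), run in exact arithmetic, reaches a solution of the equation within finitely many iteration steps: there is an index $k\ge 1$ such that $\mathscr{X}^{(k)}$ is generated by the algorithm and $\mathscr{A}*_M\mathscr{X}^{(k)}+\mathscr{X}^{(k)}*_N\mathscr{C}=\mathscr{D}$.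
   Context: Einstein product: for $\mathscr{A}\in\mathbb{R}^{I_1\times\cdots\times I_M\times J_1\times\cdots\times J_N}$ and $\mathscr{B}\in\mathbb{R}^{J_1\times\cdots\times J_N\times K_1\times\cdots\times K_L}$, $(\mathscr{A}*_N\mathscr{B})_{i_1\dots i_Mk_1\dots k_L}=\sum_{j_1,\dots,j_N}\mathscr{A}_{i_1\dots i_Mj_1\dots j_N}\mathscr{B}_{j_1\dots j_Nk_1\dots k_L}$; the subscript of $*$ is the number of contracted modes. Transpose: for $\mathscr{A}\in\mathbb{R}^{I_1\times\cdots\times I_M\times J_1\times\cdots\times J_N}$, $\mathscr{A}^T\in\mathbb{R}^{J_1\times\cdots\times J_N\times I_1\times\cdots\times I_M}$ with $(\mathscr{A}^T)_{j_1\dots j_Ni_1\dots i_M}=\mathscr{A}_{i_1\dots i_Mj_1\dots j_N}$. $\|\cdot\|$ is the Frobenius norm (square root of the sum of squares of all entries). Algorithm G (input $\mathscr{A},\mathscr{C},\mathscr{D}$ and an initial tensor $\mathscr{X}^{(1)}$): set $\mathscr{R}^{(1)}=\mathscr{D}-\mathscr{A}*_M\mathscr{X}^{(1)}-\mathscr{X}^{(1)}*_N\mathscr{C}$ and $\mathscr{P}^{(1)}=\mathscr{A}^T*_M\mathscr{R}^{(1)}+\mathscr{R}^{(1)}*_N\mathscr{C}^T$. For $k=1,2,\dots$: if $\mathscr{R}^{(k)}=0$, or if $\mathscr{R}^{(k)}\ne0$ and $\mathscr{P}^{(k)}=0$, stop; otherwise set $$\mathscr{X}^{(k+1)}=\mathscr{X}^{(k)}+\frac{\|\mathscr{R}^{(k)}\|^2}{\|\mathscr{P}^{(k)}\|^2}\mathscr{P}^{(k)},\qquad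 \mathscr{R}^{(k+1)}=\mathscr{D}-\mathscr{A}*_M\mathscr{X}^{(k+1)}-\mathscr{X}^{(k+1)}*_N\mathscr{C},$$ $$\mathscr{P}^{(k+1)}=\mathscr{A}^T*_M\mathscr{R}^{(k+1)}+\mathscr{R}^{(k+1)}*_N\mathscr{C}^T+\frac{\|\mathscr{R}^{(k+1)}\|^2}{\|\mathscr{R}^{(k)}\|^2}\mathscr{P}^{(k)}.$$ *)

(* Defs.v *)
From mathcomp Require Import all_boot all_order all_algebra.
From mathcomp Require Import reals.

Set Implicit Arguments.
Unset Strict Implicit.
Unset Printing Implicit Defensive.

Import Order.TTheory GRing.Theory Num.Theory.

Local Open Scope ring_scope.

Definition multi_index (M : nat) (I : 'I_M -> nat) : finType :=
  {dffun forall m : 'I_M, 'I_(I m)}.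

(* A tensor of order M + N, with its modes grouped as the row modes
   I_1, .., I_M followed by the column modes J_1, .., J_N: the entry at
   i_1 .. i_M j_1 .. j_N is [T (i, j)].  The codomain is R^o, i.e. R seen as a
   module over itself, so that tensors inherit the pointwise lmodType
   structure. *)
Definition tensor (R : realType) (M N : nat)
    (I : 'I_M -> nat) (J : 'I_N -> nat) : lmodType R :=
  {ffun multi_index I * multi_index J -> R^o}.

(* The number of contracted modes, N, is read off from the type of A. *)
Definition einstein (R : realType) (M N L : nat)
    (I : 'I_M -> nat) (J : 'I_N -> nat) (K : 'I_L -> nat)
    (A : tensor R I J) (B : tensor R J K) : tensor R I K :=
  [ffun ik => \sum_(j : multi_index J) (A (ik.1, j) : R) * (B (j, ik.2) : R)].

Notation "A *e B" := (einstein A B) (at level 40, left associativity).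

Definition transpose (R : realType) (M N : nat)
    (I : 'I_M -> nat) (J : 'I_N -> nat) (A : tensor R I J) : tensor R J I :=
  [ffun ji => A (ji.2, ji.1)].

Definition fnorm (R : realType) (M N : nat)
    (I : 'I_M -> nat) (J : 'I_N -> nat) (T : tensor R I J) : R :=
  Num.sqrt (\sum_(ij : multi_index I * multi_index J) (T ij : R) ^+ 2).

Definition residual (R : realType) (M N : nat)
    (I : 'I_M -> nat) (J : 'I_N -> nat)
    (A : tensor R I I) (C : tensor R J J) (D X : tensor R I J) : tensor R I J :=
  D - A *e X - X *e C.

Definition adjoint_residual (R : realType) (M N : nat)
    (I : 'I_M -> nat) (J : 'I_N -> nat)
    (A : tensor R I I) (C : tensor R J J) (Rk : tensor R I J) : tensor R I J :=
  transpose A *e Rk + Rk *e transpose C.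

(* [generated A C D X1 k X Rk P]: the algorithm started at X1 reaches iteration
   k without having stopped earlier, with X^(k) = X, R^(k) = Rk, P^(k) = P.
   Iterations are numbered from 1.  The two premises of [generated_step] negate
   the stopping test "Rk = 0, or Rk <> 0 and P = 0". *)
Inductive generated (R : realType) (M N : nat)
    (I : 'I_M -> nat) (J : 'I_N -> nat)
    (A : tensor R I I) (C : tensor R J J) (D X1 : tensor R I J) :
    nat -> tensor R I J -> tensor R I J -> tensor R I J -> Prop :=
| generated_init :
    generated A C D X1 1 X1 (residual A C D X1)
      (adjoint_residual A C (residual A C D X1))
| generated_step (k : nat) (X Rk P : tensor R I J) :
    generated A C D X1 k X Rk P ->
    Rk <> 0 -> P <> 0 ->
    let X' := X + (fnorm Rk ^+ 2 / fnorm P ^+ 2) *: P in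
    let Rk' := residual A C D X' in
    let P' := adjoint_residual A C Rk' + (fnorm Rk' ^+ 2 / fnorm Rk ^+ 2) *: P in
    generated A C D X1 k.+1 X' Rk' P'.

(* Main.v *)
Require Import Defs.
From HB Require Import structures.
From mathcomp Require Import all_boot all_order all_algebra.
From mathcomp Require Import reals.
From mathcomp Require Import ring.

(** Write [L X = A *e X + X *e C] and [L*] for its adjoint with respect to the
    Frobenius inner product, which is the same operator built from the
    transposes.  Algorithm G is then Craig's form of the conjugate gradient
    method for [L X = D]: the update of the iterate amounts to
    [R' = R - alpha *: L P], and the new direction is [L* R' + beta *: P].

    As for every conjugate gradient method, each residual is orthogonal to all
    earlier residuals and each direction to all earlier directions.  So as long
    as the run continues, the span of the directions gains one dimension per
    step ([directions_grow]), which a finite-dimensional space allows only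
    finitely often.  The run therefore stops, and it remains to exclude a stop
    at [P = 0] with [R <> 0].  This is where consistency enters: if [Xs] is a
    solution then [<P, Xs - X> = |R|^2] at every iteration, hence [P = 0] forces
    [R = 0] ([direction_neq0]).

    The orthogonality relations are carried as a statement about two subspaces,
    the span [S] of the earlier directions and the span [U] of the earlier
    residuals ([craig_invariant]); [L*] maps [U] into [S] and [L] maps [S] into
    [U] extended by the current residual.  These inclusions carry orthogonality
    to the earlier vectors over to the next step, while [alpha] and [beta] are
    chosen to make the new residual and direction orthogonal to the current ones
    ([craig_invariant_step]). *)

Set Implicit Arguments.
Unset Strict Implicit.
Unset Printing Implicit Defensive.

Import Order.TTheory GRing.Theory Num.Theory.

Local Open Scope ring_scope.

(** * The standard inner product on functions over a finite type *)

Section InnerProduct.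
Variables (R : realFieldType) (T : finType).
Local Notation V := {ffun T -> R^o}.
Implicit Types (u v w : V) (S : {vspace V}).

Definition dot u v : R := \sum_t (u t : R) * (v t : R).

Lemma dotC u v : dot u v = dot v u.
Proof. by apply: eq_bigr => t _; rewrite mulrC. Qed.

Lemma dotDl u v w : dot (u + v) w = dot u w + dot v w.
Proof. by rewrite -big_split; apply: eq_bigr => t _; rewrite ffunE mulrDl. Qed.

Lemma dotZl a u v : dot (a *: u) v = a * dot u v.
Proof. by rewrite mulr_sumr; apply: eq_bigr => t _; rewrite ffunE -mulrA. Qed.

Lemma dotDr u v w : dot u (v + w) = dot u v + dot u w.
Proof. by rewrite dotC dotDl !(dotC u). Qed.

Lemma dotZr a u v : dot u (a *: v) = a * dot u v.
Proof. by rewrite dotC dotZl dotC. Qed.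

Lemma dotBl u v w : dot (u - v) w = dot u w - dot v w.
Proof. by rewrite -scaleN1r dotDl dotZl mulN1r. Qed.

Lemma dotBr u v w : dot u (v - w) = dot u v - dot u w.
Proof. by rewrite dotC dotBl !(dotC u). Qed.

Lemma dot_eq0 u : (dot u u == 0) = (u == 0).
Proof.
apply/eqP/eqP => [u0 | ->]; last by rewrite -(scale0r 0) dotZl mul0r.
apply/ffunP => t; rewrite ffunE; apply/eqP; rewrite -sqrf_eq0 expr2.
by apply/eqP; apply: (psumr_eq0P _ u0) => // s _; rewrite -expr2 sqr_ge0.
Qed.

Definition orth u S := forall v, v \in S -> dot u v = 0.

Lemma orth_add_line u S v : orth u S -> dot u v = 0 -> orth u (S + <[v]>)%VS.
Proof.
move=> uS uv _ /memv_addP[s Ss [_ /vlineP[c ->] ->]].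
by rewrite dotDr dotZr uS // uv mulr0 addr0.
Qed.

(** Were the dimension unchanged, [v] would lie in [S] and be orthogonal to
    itself. *)
Lemma ltn_dim_add_line S v :
  orth v S -> v != 0 -> (\dim S < \dim (S + <[v]>))%N.
Proof.
move=> vS v0; rewrite ltn_neqAle dimvS ?addvSl // andbT.
apply: contraNneq v0 => dimE; rewrite -dot_eq0; apply/eqP/vS.
have /eqP -> : S == (S + <[v]>)%VS by rewrite eqEdim addvSl dimE leqnn.
by rewrite -[v in v \in _]add0r memv_add ?mem0v ?memv_line.
Qed.

End InnerProduct.

(** * Craig's method *)

Section Craig.
Variables (R : realFieldType) (T : finType).
Local Notation V := {ffun T -> R^o}.
Variables (L Lt : {linear V -> V}) (D Xs : V).
Hypothesis adjoint : forall u v, dot (Lt u) v = dot u (L v).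
Hypothesis solution : L Xs = D.

Definition craig_X (X r P : V) := X + (dot r r / dot P P) *: P.
Definition craig_R (X r P : V) := D - L (craig_X X r P).
Definition craig_P (X r P : V) :=
  let r' := craig_R X r P in Lt r' + (dot r' r' / dot r r) *: P.

(** [S] and [U] stand for the spans of the earlier directions and of the
    earlier residuals.  [inv_direction] records the recurrence for [P] without
    its coefficient, and [inv_error], the only clause that involves the solution
    [Xs], is what rules out a breakdown. *)
Record craig_invariant (S U : {vspace V}) (X r P : V) : Prop := CraigInvariant {
  inv_residual : r = D - L X;
  inv_orthP : orth P S;
  inv_orthR : orth r U;
  inv_LtU : forall u, u \in U -> Lt u \in S;
  inv_LS : forall v, v \in S -> L v \in (U + <[r]>)%VS;
  inv_direction : Lt r - P \in S;
  inv_error : dot P (Xs - X) = dot r r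
}.

(** Since [Xs] is a solution, the residual at [X] is the image under [L] of the
    error [Xs - X]. *)
Lemma dot_Lt_error X : dot (Lt (D - L X)) (Xs - X) = dot (D - L X) (D - L X).
Proof. by rewrite adjoint linearB /= solution. Qed.

Lemma craig_invariant_init X :
  craig_invariant 0 0 X (D - L X) (Lt (D - L X)).
Proof.
have orth0 u : orth u 0%VS.
  by move=> v; rewrite memv0 => /eqP ->; rewrite -(scale0r 0) dotZr mul0r.
split=> //; last exact: dot_Lt_error.
- by move=> u; rewrite !memv0 => /eqP ->; rewrite linear0.
- by move=> v; rewrite memv0 => /eqP ->; rewrite linear0 mem0v.
- by rewrite subrr mem0v.
Qed.

(** The method cannot break down: [<P, Xs - X> = |r|^2] makes [r] vanish as soon
    as [P] does. *)
Lemma direction_neq0 S U X r P :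
  craig_invariant S U X r P -> r != 0 -> P != 0.
Proof.
move=> inv; apply: contra_neq => P0; apply/eqP; rewrite -dot_eq0.
by rewrite -(inv_error inv) P0 -(scale0r 0) dotZl mul0r.
Qed.

Lemma directions_grow S U X r P :
  craig_invariant S U X r P -> P != 0 -> (\dim S < \dim (S + <[P]>))%N.
Proof. by move=> inv; apply: ltn_dim_add_line; apply: inv_orthP inv. Qed.

(** Orthogonality is moved across the adjunction: pairing [L P] with an earlier
    residual [u] gives [<P, Lt u>] with [Lt u] in [S], and pairing [Lt r'] with
    an earlier direction [v] gives [<r', L v>] with [L v] in the span of the
    residuals up to [r].  The pairings with the current [r] and [P] escape these
    inclusions; they vanish because of the values of the two coefficients. *)
Lemma craig_invariant_step S U X r P :
  craig_invariant S U X r P -> r != 0 -> P != 0 ->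
  craig_invariant (S + <[P]>) (U + <[r]>)
    (craig_X X r P) (craig_R X r P) (craig_P X r P).
Proof.
move=> [rE PS rU LtU LS dirS err] r0 P0.
have rr0 : dot r r != 0 by rewrite dot_eq0.
have PP0 : dot P P != 0 by rewrite dot_eq0.
rewrite /craig_P /=.
set X' := craig_X X r P; set r' := craig_R X r P.
set a := dot r r / dot P P; set b := dot r' r' / dot r r.
have a0 : a != 0 by rewrite mulf_neq0 ?invr_eq0.
have aPP : a * dot P P = dot r r by rewrite divfK.
have r'E : r' = r - a *: L P.
  by rewrite /r' /craig_R /craig_X linearD linearZ /= opprD addrA -rE.
have LPE : L P = a^-1 *: (r - r').
  by rewrite r'E opprB addrCA subrr addr0 scalerA mulVf ?scale1r.
have PLtr : dot P (Lt r) = dot P P.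
  by rewrite -[Lt r](subrK P) dotDr PS // add0r.
(* This is the equation that determines the step length [a]. *)
have r'r : dot r' r = 0.
  by rewrite r'E dotBl dotZl (dotC (L P)) -adjoint (dotC _ P) PLtr aPP subrr.
have r'U : orth r' (U + <[r]>).
  apply: orth_add_line => // u uU.
  rewrite r'E dotBl dotZl rU // (dotC (L P)) -adjoint dotC PS ?LtU //.
  by rewrite mulr0 subr0.
split=> //.
- apply: orth_add_line => [v vS|].
    by rewrite dotDl dotZl PS // adjoint r'U ?LS // mulr0 addr0.
  (* The terms cancel because [b = dot r' r' / (a * dot P P)]. *)
  rewrite dotDl dotZl adjoint LPE dotZr dotBr r'r sub0r /a /b.
  by field; rewrite ?rr0 ?PP0.
- move=> _ /memv_addP[u uU [_ /vlineP[c ->] ->]].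
  rewrite linearD linearZ /= -[Lt r](subrK P) scalerDr addrA.
  by rewrite memv_add ?memvZ ?memv_line // memvD ?memvZ ?LtU.
- move=> _ /memv_addP[v vS [_ /vlineP[c ->] ->]].
  rewrite linearD linearZ /=; apply: memvD.
    by apply: subvP (LS v vS); apply: addvSl.
  rewrite LPE; do 2!apply: memvZ.
  apply: memv_add; last by rewrite memvN memv_line.
  by apply: (subvP (addvSr _ _)); apply: memv_line.
- rewrite opprD addrA subrr sub0r memvN memvZ //.
  by rewrite (subvP (addvSr _ _)) ?memv_line.
- have PX' : dot P (Xs - X') = 0.
    by rewrite /X' /craig_X opprD addrA dotBr dotZr err aPP subrr.
  by rewrite dotDl dotZl PX' mulr0 addr0 dot_Lt_error.
Qed.

(** The run is described by an arbitrary predicate [G] closed under the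
    iteration, so that the result applies to any presentation of it. *)
Theorem craig_terminates (G : V -> V -> V -> Prop) X1 :
    G X1 (D - L X1) (Lt (D - L X1)) ->
    (forall X r P, G X r P -> r <> 0 -> P <> 0 ->
       G (craig_X X r P) (craig_R X r P) (craig_P X r P)) ->
  exists X r P, G X r P /\ L X = D.
Proof.
move=> G1 Gstep.
(* The codimension of the span of the earlier directions decreases. *)
have [n] := ubnP (\dim {:V} - \dim (0%VS : {vspace V})).
move: (craig_invariant_init X1) G1.
move: (X1) (D - L X1) (Lt _) 0%VS {2}0%VS.
elim: n => // n IHn X r P U S inv GX ltn.
have [r0 | r0] := eqVneq r 0.
  exists X, r, P; split=> //; apply/eqP.
  by rewrite eq_sym -subr_eq0 -(inv_residual inv) r0.
have P0 := direction_neq0 inv r0.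
apply: IHn (craig_invariant_step inv r0 P0) _ _.
  by apply: Gstep => //; apply/eqP.
rewrite ltnS in ltn; apply: leq_trans ltn.
have ltS := directions_grow inv P0.
by apply: ltn_sub2l => //; apply: leq_trans ltS (dimvS (subvf _)).
Qed.

End Craig.

(** * The Sylvester operator and its adjoint *)

Section Frobenius.
Variables (R : realType) (M N : nat) (I : 'I_M -> nat) (J : 'I_N -> nat).

Lemma fnorm_sqr (X : tensor R I J) : fnorm X ^+ 2 = dot X X.
Proof. by rewrite sqr_sqrtr ?sumr_ge0 // => ij _; rewrite sqr_ge0. Qed.

(** Separating the row and column modes lets sums over them be exchanged
    independently. *)
Lemma dot_pair (u v : tensor R I J) :
  dot u v = \sum_i \sum_j (u (i, j) : R) * (v (i, j) : R).
Proof.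
rewrite (pair_bigA _ (fun i j => (u (i, j) : R) * (v (i, j) : R))).
by apply: eq_bigr => -[].
Qed.

End Frobenius.

Section Einstein.
Variables (R : realType) (M N L : nat).
Variables (I : 'I_M -> nat) (J : 'I_N -> nat) (K : 'I_L -> nat).

Lemma einstein_adjointl (A : tensor R I J) (u : tensor R I K) (v : tensor R J K) :
  dot (transpose A *e u) v = dot u (A *e v).
Proof.
rewrite !dot_pair exchange_big [RHS]exchange_big; apply: eq_bigr => j _.
under eq_bigr do rewrite ffunE mulr_suml.
under [RHS]eq_bigr do rewrite ffunE mulr_sumr.
rewrite exchange_big; apply: eq_bigr => i _; apply: eq_bigr => k _ /=.
by rewrite ffunE mulrCA mulrA.
Qed.

Lemma einstein_adjointr (C : tensor R J K) (u : tensor R I K) (v : tensor R I J) :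
  dot (u *e transpose C) v = dot u (v *e C).
Proof.
rewrite !dot_pair; apply: eq_bigr => i _.
under eq_bigr do rewrite ffunE mulr_suml.
under [RHS]eq_bigr do rewrite ffunE mulr_sumr.
rewrite exchange_big; apply: eq_bigr => k _; apply: eq_bigr => j _ /=.
by rewrite ffunE -mulrA (mulrC (C _ : R)).
Qed.

End Einstein.

Section Sylvester.
Variables (R : realType) (M N : nat) (I : 'I_M -> nat) (J : 'I_N -> nat).
Implicit Types (A : tensor R I I) (C : tensor R J J).
(* The same module as [tensor R I J], spelled so that its finite dimension can
   be inferred. *)
Local Notation V := {ffun multi_index I * multi_index J -> R^o}.

Definition sylvester A C (X : V) : V :=
  A *e (X : tensor R I J) + (X : tensor R I J) *e C.

Lemma sylvester_linear A C : linear (sylvester A C).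
Proof.
move=> a X Y; apply/ffunP => ij; rewrite !ffunE scalerDr addrACA.
congr (_ + _); rewrite scaler_sumr -big_split; apply: eq_bigr => k _ /=;
  rewrite !ffunE ?mulrDr ?mulrDl; congr (_ + _).
  exact: mulrCA.
by rewrite -mulrA.
Qed.

HB.instance Definition _ A C :=
  GRing.isLinear.Build R V V *:%R (sylvester A C) (sylvester_linear A C).

Lemma sylvester_adjoint A C (u v : V) :
  dot (sylvester (transpose A) (transpose C) u) v = dot u (sylvester A C v).
Proof. by rewrite dotDl dotDr einstein_adjointl einstein_adjointr. Qed.

Lemma residualE A C (D X : V) : residual A C D X = D - sylvester A C X.
Proof. by rewrite /residual /sylvester opprD addrA. Qed.

End Sylvester.

Theorem theorem3p1 (R : realType) (M N : nat)
    (I : 'I_M -> nat) (J : 'I_N -> nat)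
    (A : tensor R I I) (C : tensor R J J) (D : tensor R I J)
    (consistent : exists X : tensor R I J, A *e X + X *e C = D)
    (X1 : tensor R I J) :
  exists (k : nat) (X Rk P : tensor R I J),
    [/\ (1 <= k)%N, generated A C D X1 k X Rk P & A *e X + X *e C = D].
Proof.
have [Xs XsE] := consistent.
pose G X r P := exists2 k, (1 <= k)%N & generated A C D X1 k X r P.
have [||X [r [P [[k k1 gen] XE]]]] :=
  craig_terminates (sylvester_adjoint A C) (XsE : sylvester A C Xs = D)
    (G := G) (X1 := X1).
- by exists 1%N => //; rewrite -residualE; apply: generated_init.
- move=> X r P [k _ gen] r0 P0; exists k.+1 => //.
  have := generated_step gen r0 P0.
  by rewrite /= !fnorm_sqr !residualE.
- by exists k, X, r, P.
Qed.
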